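(* Let $w_1,\dots,w_n$ be $n$ distinct integers and let the path $P_n=v_1v_2\cdots v_n$ be weighted by assigning these integers to the vertices according to a uniformly random permutation. Run the following process: initially all vertices are unmarked; while some vertex is unmarked, select the unmarked vertex $v$ of highest weight, let $v$ acquire the weight of each of its unmarked neighbours, and mark $v$ together with those neighbours. Let $A_{td}(P_n)$ be the number of vertices selected (the size of the resulting residual set). Then $$\lim_{n\to\infty}\frac{E[A_{td}(P_n)]}{n} = \frac{e^2-1}{2e^2}.$$ *)

(* Defs.v *)
From mathcomp Require Import all_boot all_order all_fingroup all_algebra.

Set Implicit Arguments.
Unset Strict Implicit.
Unset Printing Implicit Defensive.
Import Order.TTheory GRing.Theory Num.Theory.
Local Open Scope ring_scope.

Record td_state (T : finType) := TdState {
  marked : {set T};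
  weight : {ffun T -> int};
  selected : {set T} }.

(* One round on the simple graph with adjacency relation [adj]; it does nothing
   once every vertex is marked. Unmarked vertices still carry their initial
   weights, so the arg max is unique when the initial weights are distinct. *)
Definition td_step (T : finType) (adj : rel T) (st : td_state T) : td_state T :=
  if [pick u | u \notin marked st] is Some u0 then
    let v := [arg max_(u > u0 | u \notin marked st) weight st u]%O in
    let N := [set u | adj v u & u \notin marked st] in
    TdState
      (marked st :|: (v |: N))
      [ffun u => if u == v then weight st v + \sum_(x in N) weight st x
                 else if u \in N then 0 else weight st u]
      (v |: selected st)
  else st.

(* Each effective round marks a new vertex, so #|T| rounds complete the process
   (lemma [marked_td_run]). *)
Definition td_run (T : finType) (adj : rel T) (w : T -> int) : td_state T :=
  iter #|T| (td_step adj) (TdState set0 (finfun w) set0).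

Definition A_td (T : finType) (adj : rel T) (w : T -> int) : nat :=
  #|selected (td_run adj w)|.

Definition path_adj (n : nat) : rel 'I_n :=
  [rel i j : 'I_n | (i.+1 == j :> nat) || (j.+1 == i :> nat)].

Definition expected_A_td_path (R : numFieldType) (n : nat) (w : 'I_n -> int) : R :=
  (\sum_(s : {perm 'I_n}) (A_td (@path_adj n) (fun i => w (s i)))%:R)
    / #|{perm 'I_n}|%:R.

Lemma marked_td_run (T : finType) (adj : rel T) (w : T -> int) :
  marked (td_run adj w) = [set: T].
Proof.
suff H k : (minn k #|T| <= #|marked (iter k (td_step adj)
    (TdState set0 (finfun w) set0))|)%N.
  apply/eqP; rewrite eqEcard subsetT cardsT.
  by have := H #|T|; rewrite minnn.
elim: k => [|k IHk]; first by rewrite min0n.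
rewrite iterS; set st := iter _ _ _ in IHk *.
rewrite /td_step; case: pickP => [u0 u0P|allm] /=.
  case: arg_maxP => //= v vP _.
  apply: (@leq_trans #|marked st|.+1).
    apply: leq_trans (_ : (minn k #|T|).+1 <= _)%N; last by rewrite ltnS.
    by rewrite -minnSS leq_min geq_minl (leq_trans (geq_minr _ _)).
  apply/proper_card/properP; split; first exact: subsetUl.
  by exists v => //; rewrite !inE eqxx orbT.
rewrite (_ : marked st = [set: T]) ?cardsT ?geq_minr //.
by apply/setP => u; rewrite inE; have /negbFE := allm u.
Qed.

(* Main.v *)
(* The highest-weight unmarked vertex of the path is selected, so a vertex is
   selected exactly when it has no selected neighbour of greater weight. On a
   path this means that the ascending runs of weights leaving the vertex to the
   left and to the right both have an even number of steps. Writing the parity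
   indicator of a run length l as \sum_(a <= l) (-1)^a, the expectation becomes an
   alternating sum of probabilities that the weights increase for a steps to
   the left and b steps to the right of a vertex, namely
   'C(a + b, a) / (a + b + 1)!. Summing over all windows of m + 1 vertices, the
   increments of the expectation in n are the partial sums of
   \sum_m (-2)^m / (m + 1)! = (1 - e^-2) / 2, and Cesaro's lemma applies. *)
Require Import Defs.
From mathcomp Require Import all_boot all_order all_fingroup all_algebra.
From mathcomp Require Import all_classical all_reals all_analysis.
From mathcomp Require Import ring.
Import Order.TTheory GRing.Theory Num.Theory.
Import numFieldNormedType.Exports.

Set Implicit Arguments.
Unset Strict Implicit.
Unset Printing Implicit Defensive.

Local Open Scope ring_scope.

(** * Greedy selection and parities of runs *)

(** A heavier neighbour of the arg max [v] is already marked; were it in [P], it would have been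
    selected and would have marked [v]. So [v] is in [P], and the neighbours marked with it are not,
    because [v] is heavier. *)
Lemma selected_td_run (T : finType) (adj : rel T) (w : T -> int) (P : pred T) :
    symmetric adj -> injective w ->
    (forall u, P u = ~~ [exists v, [&& adj u v, w u < w v & P v]]) ->
  selected (td_run adj w) = [set u | P u].
Proof.
move=> adjC w_inj PE.
suff inv k : let st := iter k (td_step adj) (TdState finset.set0 (finfun w) finset.set0) in
    [/\ {in [predC marked st], weight st =1 w},
        selected st = [set u in marked st | P u]
      & forall u v, u \in selected st -> adj u v -> v \in marked st].
  case: (inv #|T|) => _; rewrite -/(td_run adj w) => -> _.
  by apply/setP => u; rewrite marked_td_run !inE.
elim: k => [|k IHk] /=.
  by split=> [u|/=|u v]; rewrite ?ffunE ?inE//; apply/setP => u; rewrite !inE.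
move: (iter k _ _) IHk => st [weightE selE selN].
rewrite /td_step; case: pickP => [u0 u0P|_]; last by split.
case: arg_maxP => //= v vM vmax.
have wmax u : u \notin marked st -> u != v -> w u < w v.
  move=> uM uv; rewrite lt_neqAle (inj_eq w_inj) uv /=.
  by have := vmax u uM; rewrite !weightE.
have Pv : P v.
  rewrite PE; apply/existsP => -[x /and3P[vx ltvx Px]].
  have [xM|xM] := boolP (x \in marked st).
    have /selN/(_ _) : x \in selected st by rewrite selE inE xM.
    by move=> /(_ v); rewrite adjC => /(_ vx); rewrite (negPf vM).
  have := wmax x xM; case: eqVneq ltvx => [->|_ ltvx /(_ isT)].
    by rewrite ltxx.
  by move/(lt_trans ltvx); rewrite ltxx.
split.
- move=> u; rewrite !inE !negb_or ffunE => /and3P[uM /negPf-> uN].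
  by rewrite inE (negPf uN) weightE.
- rewrite selE; apply/setP => u; rewrite !inE.
  have [->|uv] /= := eqVneq u v; first by rewrite orbT Pv.
  have [//|uM] /= := boolP (u \in marked st).
  rewrite andbT; case: (boolP (adj v u)) => //= vu; apply/esym/negbTE.
  rewrite PE negbK; apply/existsP; exists v.
  by rewrite adjC vu Pv wmax.
- move=> u x; rewrite !inE => /orP[/eqP->|uS] ux; last by rewrite (selN u x).
  by rewrite ux; case: (x \in _); rewrite ?orbT.
Qed.

(* [unblocked r x s] says that the maximal [r]-chain at the front of [x :: s]
   makes an even number of steps: if [r] compares weights and [s] lists the
   vertices on one side of [x], then [x] is not marked from that side before its
   turn. *)
Fixpoint unblocked (T : Type) (r : rel T) (x : T) (s : seq T) : bool :=
  if s is y :: s' then ~~ (r x y && unblocked r y s') else true.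

Lemma unblocked_sum (R : pzRingType) (T : Type) (r : rel T) (x : T) (s : seq T) :
  (unblocked r x s)%:R =
  \sum_(a < (size s).+1) (-1) ^+ a * (path r x (take a s))%:R :> R.
Proof.
elim: s x => [|y s IHs] x /=; first by rewrite big_ord1 expr0 mul1r.
rewrite big_ord_recl /= expr0 mul1r; case: (r x y) => /=; last first.
  by rewrite big1 ?addr0// => a _; rewrite mulr0.
under eq_bigr do rewrite /= exprS -mulrA mulN1r.
by rewrite sumrN -IHs; case: (unblocked r y s); rewrite ?subrr ?subr0.
Qed.

(** * Counting linear orders *)

Lemma count_sorted_permutations (T : eqType) (r : rel T) (q : seq T) :
    transitive r -> irreflexive r -> (forall x y, x != y -> r x y || r y x) ->
  uniq q -> count (sorted r) (permutations q) = 1%N.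
Proof.
move=> r_tr r_irr r_tot uq.
(* [sort] is controlled by a total relation, hence the reflexive closure; uniqueness of the entries
   restores strictness. *)
pose r' x y := (x == y) || r x y.
have r'_tot : total r'.
  by move=> x y; rewrite /r' (eq_sym y); case: eqVneq => //= /r_tot.
have srt : sorted r (sort r' q).
  have r'_tr : transitive r'.
    move=> y x z /orP[/eqP->//|xy] /orP[/eqP<-|yz]; apply/orP; right => //.
    exact: r_tr yz.
  have : sorted [rel x y | (x != y) && r' x y] (sort r' q).
    rewrite (sorted_pairwise); last first.
      move=> y x z /=.
      move=> /andP[xy /orP[|rxy]]; first by rewrite (negPf xy).
      move=> /andP[yz /orP[|ryz]]; first by rewrite (negPf yz).
      have rxz := r_tr _ _ _ rxy ryz.
      rewrite /r' rxz orbT andbT; apply/eqP => xz.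
      by move: rxz; rewrite xz r_irr.
    rewrite pairwise_relI -uniq_pairwise sort_uniq uq /=.
    by rewrite -(sorted_pairwise r'_tr) sort_sorted.
  by apply: sub_sorted => x y /= /andP[/negPf xy]; rewrite /r' xy.
rewrite (@eq_in_count _ _ (pred1 (sort r' q))).
  rewrite count_uniq_mem ?permutations_uniq// mem_permutations.
  by rewrite perm_sort perm_refl.
move=> q'; rewrite mem_permutations => qq' /=.
apply/idP/eqP => [sq'|->//].
apply: (irr_sorted_eq r_tr r_irr) => // x.
by rewrite mem_sort (perm_mem qq').
Qed.

Lemma perm_eq_perm_map (T : finType) (q q' : seq T) : uniq q -> perm_eq q q' ->
  exists t : {perm T}, map t q = q'.
Proof.
move=> uq qq'; have uq' : uniq q' by rewrite -(perm_uniq qq').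
have sq := perm_size qq'.
(* The default [x] makes [h] the identity outside [q], so [h] is a bijection of all of [T]. *)
pose h x := nth x q' (index x q).
have hin x : x \in q -> h x \in q'.
  by move=> xq; rewrite mem_nth// -sq index_mem.
have hout x : x \notin q -> h x = x.
  by move=> xq; rewrite /h nth_default// -sq leqNgt index_mem.
have h_inj : injective h.
  move=> x y; have [xq|xq] := boolP (x \in q); have [yq|yq] := boolP (y \in q).
  - rewrite /h (set_nth_default x y) -?sq ?index_mem// => /eqP.
    rewrite nth_uniq// -?sq ?index_mem// => /eqP eqi.
    by rewrite -(nth_index x xq) eqi nth_index.
  - move=> e; have := hin _ xq; rewrite e hout// -(perm_mem qq').
    by rewrite (negPf yq).
  - move=> e; have := hin _ yq; rewrite -e hout// -(perm_mem qq').
    by rewrite (negPf xq).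
  - by rewrite !hout.
exists (perm h_inj); case: q => [|x0 q] in uq qq' sq h hin hout h_inj *.
  by apply/esym/nilP; rewrite /nilp -sq.
apply: (@eq_from_nth _ x0); first by rewrite size_map.
move=> i; rewrite size_map => ltiq.
rewrite (nth_map x0)// permE /h index_uniq//.
by apply: set_nth_default; rewrite -sq.
Qed.

Section RandomOrder.
Variables (T : finType) (disp : Order.disp_t) (D : orderType disp) (w : T -> D).
Hypothesis w_inj : injective w.
Implicit Types (s : {perm T}) (x y c : T) (p q xs ys : seq T).

Definition perm_lt s : rel T := [rel x y | (w (s x) < w (s y))%O].

Lemma perm_lt_trans s : transitive (perm_lt s).
Proof. by move=> y x z; apply: lt_trans. Qed.

Lemma perm_lt_total s x y : x != y -> perm_lt s x y = ~~ perm_lt s y x.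
Proof.
move=> xy; rewrite /perm_lt /= -leNgt lt_neqAle.
by rewrite (inj_eq w_inj) (inj_eq perm_inj) xy.
Qed.

(** Double counting: each [s] sorts exactly one arrangement of [q], and composing [s] with a fixed
    permutation shows that all arrangements are sorted equally often. *)
Lemma count_sorted_perm_lt q : uniq q ->
  ((\sum_s sorted (perm_lt s) q) * (size q)`! = #|{perm T}|)%N.
Proof.
move=> uq.
have eq_cnt q' : q' \in permutations q ->
    (\sum_s sorted (perm_lt s) q' = \sum_s sorted (perm_lt s) q)%N.
  rewrite mem_permutations perm_sym => /(perm_eq_perm_map uq)[t <-].
  rewrite [RHS](reindex_inj (mulgI t)); apply: eq_bigr => s _ /=.
  rewrite sorted_map; congr (nat_of_bool _); apply: eq_sorted => x y /=.
  by rewrite /perm_lt /= !permM.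
transitivity (\sum_(q' <- permutations q) \sum_s sorted (perm_lt s) q')%N.
  rewrite (eq_big_seq _ eq_cnt) big_const_seq iter_addn_0 count_predT.
  by rewrite size_permutations.
rewrite exchange_big /= -[RHS]sum1_card; apply: eq_bigr => s _.
rewrite -[RHS](@count_sorted_permutations _ (perm_lt s) q)//.
- by rewrite -sum1_count [RHS]big_mkcond; apply: eq_bigr => q' _; case: sorted.
- exact: perm_lt_trans.
- by move=> x; rewrite /perm_lt /= ltxx.
- by move=> x y /(perm_lt_total s)->; case: perm_lt.
Qed.

(* Comparing the first entries of [xs] and [ys] decides which of them extends
   the chain [p ++ [:: c]]: this is Pascal's rule. *)
Lemma count_fork_perm_lt p c xs ys : uniq (p ++ c :: xs ++ ys) ->
  ((\sum_s [&& sorted (perm_lt s) (rcons p c), path (perm_lt s) c xs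
             & path (perm_lt s) c ys])
     * (size p + size xs + size ys).+1`!
   = 'C(size xs + size ys, size xs) * #|{perm T}|)%N.
Proof.
have sortedE s l x l' : sorted (perm_lt s) (l ++ x :: l') =
    sorted (perm_lt s) (rcons l x) && path (perm_lt s) x l'.
  case: l => //= a l; rewrite -cat_rcons cat_path last_rcons; congr (_ && _).
(* Whichever branch loses its head, the total length drops by one, [c] joins [p], and the head
   becomes the new fork point. *)
have [k] := ubnP (size xs + size ys).
elim: k => // k IHk in p c xs ys *; rewrite ltnS => lek.
case: xs lek => [|x xs] lek u.
  rewrite bin0 mul1n -(count_sorted_perm_lt u) size_cat /= addn0 addnS.
  by congr (_ * _)%N; apply: eq_bigr => s _; rewrite sortedE.
case: ys lek u => [|y ys] lek u.
  rewrite /= !addn0 binn mul1n -(count_sorted_perm_lt u) size_cat /= cats0 !addnS.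
  by congr (_ * _)%N; apply: eq_bigr => s _; rewrite sortedE andbT.
have neqxy : x != y.
  move: u; rewrite cat_uniq => /and3P[_ _] /= /and3P[_ + _].
  by rewrite mem_cat inE; case: eqVneq; rewrite ?orbT.
rewrite (eq_bigr (fun s =>
    [&& sorted (perm_lt s) (rcons (rcons p c) x), path (perm_lt s) x xs
      & path (perm_lt s) x (y :: ys)] +
    [&& sorted (perm_lt s) (rcons (rcons p c) y), path (perm_lt s) y (x :: xs)
      & path (perm_lt s) y ys])%N); last first.
  move=> s _; have rcE z : sorted (perm_lt s) (rcons (rcons p c) z) =
      sorted (perm_lt s) (rcons p c) && perm_lt s c z.
    by rewrite -(cats1 _ z) cat_rcons sortedE /= andbT.
  rewrite !rcE; have := @perm_lt_trans s; have := perm_lt_total s neqxy.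
  move: (perm_lt s) => r /= rxy r_tr.
  case: (sorted r _) => //=; case: (path r x xs); rewrite /= ?andbF ?andbT //.
  case: (path r y ys); rewrite /= ?andbF ?andbT // rxy.
  case: (boolP (r y x)) => [yx|nyx] /=; rewrite ?andbT ?andbF.
    by case: (boolP (r c y)) => [cy|]; rewrite ?andbF// (r_tr _ _ _ cy yx).
  rewrite -rxy in nyx; rewrite addn0.
  by case: (boolP (r c x)) => [cx|]//=; rewrite (r_tr _ _ _ cx nyx).
rewrite big_split /= mulnDl.
have := IHk (rcons p c) x xs (y :: ys); have := IHk (rcons p c) y (x :: xs) ys.
move: lek; rewrite size_rcons /= !(addnS, addSn) => lek -> //.
  move=> -> //; first by rewrite -mulnDl binS addnC.
  by rewrite cat_rcons.
rewrite cat_rcons (perm_uniq (s2 := p ++ c :: (x :: xs) ++ y :: ys))//.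
rewrite perm_cat2l perm_cons.
exact/permPl/(perm_catCA [:: y] (x :: xs) ys).
Qed.
End RandomOrder.

(** * The residual set of the path *)

(** Seen from a heavier neighbour of [u], the weight drops towards [u], so that side is unblocked
    for free. Only the far side counts, and this is the one-step recursion of [unblocked]. *)
Lemma A_td_path (n : nat) (w : 'I_n.+1 -> int) : injective w ->
  let r := [rel x y | w (inord x) < w (inord y)] in
  A_td (@path_adj n.+1) w =
  (\sum_(i < n.+1)
     (unblocked r i (rev (iota 0 i)) && unblocked r i (iota i.+1 (n - i))))%N.
Proof.
move=> w_inj r.
pose L i := unblocked r i (rev (iota 0 i)).
pose U i := unblocked r i (iota i.+1 (n - i)).
have LS i : L i.+1 = ~~ (r i.+1 i && L i).
  by rewrite /L -addn1 iotaD rev_cat.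
have US i : (i < n)%N -> U i = ~~ (r i i.+1 && U i.+1).
  by move=> ltin; rewrite /U -(subnSK ltin).
have rN x y : r x y -> r y x = false.
  by move=> /= /lt_gtF.
have [adjC PE] : symmetric (@path_adj n.+1) /\ forall u : 'I_n.+1, L u && U u =
    ~~ [exists v : 'I_n.+1, [&& path_adj u v, w u < w v & L v && U v]].
  split=> [u v|u]; first by rewrite /path_adj /= orbC.
  have rE (x y : 'I_n.+1) : (w x < w y) = r x y by rewrite /= !inord_val.
  apply/idP/negP => [/andP[Lu Uu] /existsP[v /and3P[/orP[]/eqP uv]]|noex].
  - move: (ltn_ord v); rewrite -uv rE -uv ltnS => /US UE ruv /andP[_ Uv].
    by move: Uu; rewrite UE ruv Uv.
  - rewrite rE -uv => ruv /andP[Lv _].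
    by move: Lu; rewrite -uv LS ruv Lv.
  - apply/andP; split.
      case eqi: (u : nat) => [//|i].
      rewrite LS; apply/negP => /andP[rui Li].
      have lti : (i < n)%N by rewrite -ltnS -eqi.
      apply: noex; apply/existsP.
      exists (Ordinal (ltnW lti : i < n.+1)%N).
      apply/and4P; split; [by rewrite /path_adj /= eqi eqxx orbT| |exact: Li|].
        by rewrite rE eqi.
      by rewrite -[U _]/(U i) US// (rN _ _ rui).
    have [ltun|] := ltnP u n; last first.
      by rewrite -subn_eq0 => /eqP un0; rewrite /U un0.
    rewrite US//; apply/negP => /andP[rui Ui].
    apply: noex; apply/existsP; exists (Ordinal (ltun : u.+1 < n.+1)%N).
    apply/and4P; split; [by rewrite /path_adj /= eqxx|by rewrite rE| |exact: Ui].
    by rewrite -[L _]/(L u.+1) LS (rN _ _ rui).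
rewrite /A_td (selected_td_run adjC w_inj PE) -sum1_card big_mkcond /=.
by apply: eq_bigr => i _; rewrite inE -/(L i) -/(U i); case: (_ && _).
Qed.

(** * The expectation as a finite sum *)

Section ExpectedSize.
Variable R : numFieldType.

Definition fork_term (a b : nat) : R :=
  (-1) ^+ (a + b) * ('C(a + b, a)%:R / (a + b).+1`!%:R).

Lemma expected_A_td_pathE (n : nat) (w : 'I_n.+1 -> int) : injective w ->
  expected_A_td_path R w =
  \sum_(i < n.+1) \sum_(a < i.+1) \sum_(b < (n - i).+1) fork_term a b.
Proof.
move=> w_inj.
have card_neq0 : #|{perm 'I_n.+1}|%:R != 0 :> R.
  by rewrite pnatr_eq0 -lt0n; apply/card_gt0P; exists 1%g.
apply: (canLR (mulfK card_neq0)).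
under eq_bigr => s _.
  rewrite A_td_path ?natr_sum; last exact: inj_comp w_inj perm_inj.
  under eq_bigr do rewrite -mulnb natrM !unblocked_sum big_distrlr /=.
  over.
rewrite exchange_big mulr_suml; apply: eq_bigr => i _.
rewrite size_rev size_iota.
rewrite exchange_big mulr_suml; apply: eq_bigr => a _.
rewrite exchange_big mulr_suml size_iota; apply: eq_bigr => b _.
set xs := [seq inord k | k <- take a (rev (iota 0 i))] : seq 'I_n.+1.
set ys := [seq inord k | k <- take b (iota i.+1 (n - i))] : seq 'I_n.+1.
have szx : size xs = a.
  by rewrite size_map size_takel// size_rev size_iota -ltnS.
have szy : size ys = b by rewrite size_map size_takel// size_iota -ltnS.
have ltL k : k \in take a (rev (iota 0 i)) -> (k < i)%N.
  by move=> /mem_take; rewrite mem_rev mem_iota.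
have ltU k : k \in take b (iota i.+1 (n - i)) -> (i < k < n.+1)%N.
  by move=> /mem_take; rewrite mem_iota addSn subnKC // -ltnS.
(* The fork has empty stem; its branches lie on opposite sides of [i], at indices where [inord] is
   injective. *)
have u : uniq ([::] ++ (inord i : 'I_n.+1) :: xs ++ ys).
  rewrite -map_cat -map_cons map_inj_in_uniq.
    rewrite /= mem_cat cat_uniq !take_uniq ?rev_uniq ?iota_uniq// andbT /=.
    apply/andP; split.
      by apply/norP; split; apply/negP;
        [move=> /ltL|move=> /ltU/andP[]]; rewrite ltnn.
    apply/hasPn => k /ltU/andP[ltik _]; apply/negP => /ltL.
    by rewrite ltnNge ltnW.
  apply: (can_in_inj (g := val)) => k; rewrite inE mem_cat => k_in.
  apply: inordK; case/or3P: k_in => [/eqP->//|/ltL|/ltU/andP[]//].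
  by move/ltn_trans; apply.
have := count_fork_perm_lt w_inj u; rewrite szx szy /= add0n => cnt.
transitivity ((-1) ^+ (a + b) * (\sum_s (path (perm_lt w s) (inord i) xs
    && path (perm_lt w s) (inord i) ys))%:R : R).
  rewrite natr_sum mulr_sumr; apply: eq_bigr => s _.
  by rewrite !path_map -mulnb natrM mulrACA -exprD.
rewrite /fork_term -mulrA; congr (_ * _).
rewrite mulrAC; apply: (canRL (mulfK _)).
  by rewrite pnatr_eq0 -lt0n fact_gt0.
by rewrite -!natrM cnt.
Qed.

Lemma sum_antidiagonals (V : nmodType) (F : nat -> nat -> V) (n : nat) :
  \sum_(b < n) \sum_(a < n - b) F a b =
  \sum_(m < n) \sum_(b < m.+1) F (m - b)%N b.
Proof.
elim: n => [|n IHn]; first by rewrite !big_ord0.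
rewrite big_ord_recr [RHS]big_ord_recr /= -IHn subSnn big_ord1.
rewrite [X in _ = _ + X]big_ord_recr /= subnn addrA -big_split /=.
congr (_ + _); apply: eq_bigr => b _.
by rewrite subSn ?big_ord_recr// ltnW.
Qed.

(** The binomial theorem for [(1 + 1) ^ m], as sign and factorial depend only on [a + b = m]. *)
Lemma sum_fork_term (m : nat) :
  \sum_(b < m.+1) fork_term (m - b) b = (-2) ^+ m / m.+1`!%:R.
Proof.
under eq_bigr => b _.
  rewrite /fork_term subnK; last by rewrite -ltnS.
  rewrite mulrA bin_sub; last by rewrite -ltnS.
  over.
rewrite -mulr_suml -mulr_sumr -natr_sum -[in RHS]mulN1r exprMn -natrX.
congr (_ * _%:R / _); rewrite -[2%N]/(1 + 1)%N Pascal.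
by apply: eq_bigr => b _; rewrite !exp1n !muln1.
Qed.

(** Adding a last vertex adds exactly the terms whose right arm ends there; these fill a triangle in
    [(a, b)], which is summed by antidiagonals. *)
Lemma expected_A_td_path_series (n : nat) (w : 'I_n.+1 -> int) : injective w ->
  expected_A_td_path R w =
  \sum_(k < n.+1) \sum_(m < k.+1) (-2) ^+ m / m.+1`!%:R.
Proof.
move=> /expected_A_td_pathE ->; elim: {w}n => [|n IHn].
  by rewrite !big_ord1 -sum_fork_term big_ord1.
rewrite [RHS]big_ord_recr /= -{}IHn.
under [in RHS]eq_bigr do rewrite -sum_fork_term.
rewrite -sum_antidiagonals big_ord_recr /=.
under eq_bigr => i _.
  rewrite subSn; last by rewrite -ltnS.
  under eq_bigr do rewrite big_ord_recr /=.
  rewrite big_split /=.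
  over.
rewrite big_split -addrA; congr (_ + _).
(* Reversal matches the arm length [b] with the position [i = n.+1 - b] of its vertex. *)
rewrite subnn [RHS](reindex_inj rev_ord_inj) /= [RHS]big_ord_recr /=.
rewrite subnn subn0; congr (_ + _); last first.
  by apply: eq_bigr => a _; rewrite big_ord1.
apply: eq_bigr => i _; rewrite subSS.
have lein : (i <= n)%N by rewrite -ltnS.
by rewrite (subSn lein) subSS subSn ?leq_subr// subKn.
Qed.

End ExpectedSize.

(** * Passage to the limit *)

Local Open Scope classical_set_scope.
Local Open Scope ring_scope.

Lemma cvg_shifted_exp_series (R : realType) (x : R) : x != 0 ->
  (fun n => \sum_(m < n.+1) x ^+ m / m.+1`!%:R) @ \oo --> (expR x - 1) / x.
Proof.
move=> x0; have cvg_exp : series (exp_coeff x) @ \oo --> expR x.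
  exact: is_cvg_series_exp_coeff.
(* Multiplied by [x], the sum is the exponential series without its constant term, whence [n.+2]
   terms and the [- 1]. *)
have eqS n : \sum_(m < n.+1) x ^+ m / m.+1`!%:R =
    (series (exp_coeff x) n.+2 - 1) / x.
  rewrite seriesEord [X in _ = (X - _) / _]big_ord_recl /exp_coeff /= expr0 divr1.
  rewrite [1 + _]addrC addrK mulr_suml.
  by apply: eq_bigr => m _; rewrite exprSr [RHS]mulrAC mulfK.
under eq_fun do rewrite eqS.
apply: cvgMl; apply: cvgB; last exact: cvg_cst.
by move: cvg_exp; rewrite -(cvg_shiftn 2); under eq_fun do rewrite addn2.
Qed.

Theorem theorem3p9 (R : realType) (w : forall n : nat, 'I_n -> int)
    (w_inj : forall n : nat, injective (w n)) :
  (fun n : nat => expected_A_td_path R (w n) / n%:R) @ \oo -->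
    (((expR 1 : R) ^+ 2 - 1) / (2 * expR 1 ^+ 2) : R).
Proof.
have <- : (expR (- 2) - 1) / (- 2) = (expR 1 ^+ 2 - 1) / (2 * expR 1 ^+ 2) :> R.
  have -> : expR (- 2) = (expR 1 ^+ 2)^-1 :> R.
    by rewrite expRN -expRM_natl mulr1.
  have : expR 1 != 0 :> R by rewrite gt_eqF ?expR_gt0.
  by move: (expR 1) => e e0; field.
(* After the shift to [n.+1] vertices, the quotient is the arithmetic mean of the first [n.+1]
   partial sums. *)
rewrite -cvg_shiftS.
have : (-2 : R) != 0 by rewrite oppr_eq0 pnatr_eq0.
move=> /cvg_shifted_exp_series/cesaro; apply: cvg_trans; apply: near_eq_cvg.
near=> n.
by rewrite /arithmetic_mean /= expected_A_td_path_series// seriesEord mulrC.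
Unshelve. all: by end_near. Qed.
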